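(* For every integer $n\ge0$ and every $\zeta>0$, the first-order derivatives of the polynomials $P_n^{(\ell)}(x;\zeta)$ with respect to $x$ satisfy $$\frac{\partial P_{n+1}^{(0)}}{\partial x}=\frac{n+1}{\tilde p_n}P_n^{(1)}+\zeta r_nP_{n-1}^{(1)},$$ $$(x^2-1)\frac{\partial P_n^{(1)}}{\partial x}+xP_n^{(1)}=(n+1)\tilde p_nP_{n+1}^{(0)}+\zeta p_nP_n^{(0)}.$$
   Context: For $\zeta>0$ let $K_1(\zeta)=\int_0^\infty\cosh(\vartheta)e^{-\zeta\cosh\vartheta}d\vartheta$. For $\ell\in\{0,1\}$ let $\omega^{(\ell)}(x;\zeta)=K_1(\zeta)^{-1}(x^2-1)^{\ell-1/2}e^{-\zeta x}$ on $[1,\infty)$ and $(f,g)_{\omega^{(\ell)}}=\int_1^\infty f(x)g(x)\omega^{(\ell)}(x;\zeta)dx$. $\{P_n^{(\ell)}(x;\zeta)\}_{n\ge0}$ are the orthonormal polynomials in $x$ for $(\cdot,\cdot)_{\omega^{(\ell)}}$, $\deg P_n^{(\ell)}=n$, with leading coefficient $c_n^{(\ell)}>0$. Put $p_n=c_n^{(0)}/c_n^{(1)}$, $r_n=c_{n-1}^{(1)}/c_{n+1}^{(0)}$, $\tilde p_n=c_n^{(1)}/c_{n+1}^{(0)}$. Convention: $P_{-1}^{(1)}=0$, so the term $\zeta r_nP_{n-1}^{(1)}$ vanishes for $n=0$. *)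

(* Defs.v *)
From HB Require Import structures.
From mathcomp Require Import all_boot all_order all_algebra.
From mathcomp Require Import all_classical all_reals all_analysis.

Set Implicit Arguments.
Unset Strict Implicit.
Unset Printing Implicit Defensive.

Import Order.TTheory GRing.Theory Num.Theory.
Import numFieldNormedType.Exports.

Local Open Scope classical_set_scope.
Local Open Scope ring_scope.

Definition cosh (R : realType) (t : R) : R := (expR t + expR (- t)) / 2.

Definition besselK1 (R : realType) (zeta : R) : R :=
  \int[lebesgue_measure]_(t in `[0, +oo[) (cosh t * expR (- (zeta * cosh t))).

(* For l = 0 the formula is singular at x = 1, where powR gives it the value 0;
   this single point does not affect the integrals below. *)
Definition weight (R : realType) (l : nat) (zeta x : R) : R :=
  (besselK1 zeta)^-1 * (x ^+ 2 - 1) `^ (l%:R - 2^-1) * expR (- (zeta * x)).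

Definition wdot (R : realType) (l : nat) (zeta : R) (f g : R -> R) : R :=
  \int[lebesgue_measure]_(x in `[1, +oo[) (f x * g x * weight l zeta x).

(* These conditions determine the sequence P uniquely. *)
Definition orthonormal_polys (R : realType) (l : nat) (zeta : R)
    (P : nat -> {poly R}) : Prop :=
  [/\ forall n, size (P n) = n.+1,
      forall n, 0 < lead_coef (P n) &
      forall m n, wdot l zeta (horner (P m)) (horner (P n)) = (m == n)%:R].

(* P_(n-1), with the convention P_(-1) = 0. *)
Definition prev_poly (R : realType) (P : nat -> {poly R}) (n : nat) : {poly R} :=
  if n is m.+1 then P m else 0.

(* In the three ratios below P0 and P1 stand for the families with l = 0 and
   l = 1; r_coef P0 P1 0 is 0, since prev_poly P1 0 = 0. *)
Definition p_coef (R : realType) (P0 P1 : nat -> {poly R}) (n : nat) : R :=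
  lead_coef (P0 n) / lead_coef (P1 n).

Definition r_coef (R : realType) (P0 P1 : nat -> {poly R}) (n : nat) : R :=
  lead_coef (prev_poly P1 n) / lead_coef (P0 n.+1).

Definition pt_coef (R : realType) (P0 P1 : nat -> {poly R}) (n : nat) : R :=
  lead_coef (P1 n) / lead_coef (P0 n.+1).

(* Main.v *)
Require Import Defs.
From HB Require Import structures.
From mathcomp Require Import all_boot all_order all_algebra.
From mathcomp Require Import all_classical all_reals all_analysis.
From mathcomp Require Import measurable_realfun.
From mathcomp Require Import ring lra zify.

Set Implicit Arguments.
Unset Strict Implicit.
Unset Printing Implicit Defensive.

Import Order.TTheory GRing.Theory Num.Theory.
Import numFieldNormedType.Exports.

Local Open Scope classical_set_scope.
Local Open Scope ring_scope.

(** Write w_0 and w_1 for the two weights. On [1, +oo[ one has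
    w_1 = (x^2 - 1) w_0 and, for x > 1, w_1' = (x - zeta (x^2 - 1)) w_0, so that
    for every polynomial p
      (p w_1)' = (D p - zeta (x^2 - 1) p) w_0,  D p = (x^2 - 1) p' + x p.
    The function p w_1 vanishes at 1 and at +oo. With L(p) the integral of
    p w_0, this says L(D p) = zeta L((x^2 - 1) p) ([moment_wderiv]). At a
    product p q, since D (p q) = (x^2 - 1) p' q + p D q, this gives the
    adjunction
      (p', q)_1 = (p, zeta (x^2 - 1) q - D q)_0,  ([adjoint_wderiv])
    where (.,.)_l is the inner product of weight w_l.

    Both identities are then expansions in an orthonormal basis. The derivative
    of P0_(n+1) has degree n; its coefficient on P1_k is the inner product of
    P0_(n+1) with a polynomial of degree k + 2, which is 0 for k < n - 1 and
    zeta times a ratio of leading coefficients for k = n - 1. The coefficient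
    for k = n comes from comparing leading coefficients. In the same way D P1_n
    has degree n + 1, and its coefficient on P0_k is zeta (P0_k, P1_n)_1 for
    k <= n, which is 0 unless k = n. This part is algebra about a linear
    functional L on polynomials ([deriv_orthonormal],
    [wderiv_orthonormal]).

    Linearity of L needs p w_0 to be integrable for every polynomial p. The
    integrals in the hypotheses are the finite parts of extended real integrals,
    and the finite part of an infinite integral is 0; hence the value 1 for the
    squared norms already forces each P_n^2 w_0 to be integrable, and
    integrability of p w_0 follows ([orthonormal_polys_integrable]). *)

(** * Linear functionals on polynomials *)

Section ScalarFunctional.
Variables (F : fieldType) (L : {poly F} -> F).
Hypothesis linL : scalar L.

Lemma scalar_fun0 : L 0 = 0.
Proof. by have := linL (-1) 0 0; rewrite scaler0 addr0 mulN1r addNr. Qed.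

Lemma scalar_funZ a p : L (a *: p) = a * L p.
Proof. by rewrite -[a *: p]addr0 linL scalar_fun0 addr0. Qed.

Lemma scalar_funD p q : L (p + q) = L p + L q.
Proof. by rewrite -[p]scale1r linL mul1r scale1r. Qed.

Lemma scalar_funB p q : L (p - q) = L p - L q.
Proof. by rewrite scalar_funD -scaleN1r scalar_funZ mulN1r. Qed.

Lemma scalar_funMl w : scalar (fun p => L (w * p)).
Proof. by move=> a p q; rewrite mulrDr -scalerAr linL. Qed.

End ScalarFunctional.

(** * Expansions in orthonormal polynomials *)

Section OrthonormalPolynomials.
Variables (F : fieldType) (P : nat -> {poly F}).
Hypothesis sizeP : forall n, size (P n) = n.+1.

Lemma lead_coef_basis_neq0 n : lead_coef (P n) != 0.
Proof. by rewrite lead_coef_eq0 -size_poly_eq0 sizeP. Qed.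

Lemma size_cancel_top n (q : {poly F}) : (size q <= n.+1)%N ->
  (size (q - (q`_n / lead_coef (P n)) *: P n)%R <= n)%N.
Proof.
move=> sq; apply/leq_sizeP => j; rewrite leq_eqVlt coefB coefZ.
case/predU1P => [<-|nj].
  have -> : (P n)`_n = lead_coef (P n) by rewrite lead_coefE sizeP.
  by rewrite divfK ?subrr// lead_coef_basis_neq0.
rewrite [q`_j]nth_default; last exact: leq_trans sq nj.
by rewrite [(P n)`_j]nth_default ?mulr0 ?subr0// sizeP.
Qed.

(** A sequence with one polynomial in each degree is a basis, compatibly with
    the degree filtration. *)
Lemma poly_span_ind (Q : {poly F} -> Prop) (m : nat) :
    Q 0 -> (forall a p q, Q p -> Q q -> Q (a *: p + q)) ->
    (forall k, (k < m)%N -> Q (P k)) ->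
  forall q : {poly F}, (size q <= m)%N -> Q q.
Proof.
move=> Q0 QD; elim: m => [|m IH] QP q sq.
  by move: sq; rewrite leqn0 size_poly_eq0 => /eqP ->.
rewrite -[q](subrK ((q`_m / lead_coef (P m)) *: P m)) addrC.
apply: QD; first exact: QP.
by apply: IH (size_cancel_top sq) => k km; apply: QP; exact: ltnW.
Qed.

Variable L : {poly F} -> F.
Hypothesis linL : scalar L.
Hypothesis orthP : forall m n, L (P m * P n) = (m == n)%:R.

Lemma orthonormal_lt n (q : {poly F}) : (size q <= n)%N -> L (q * P n) = 0.
Proof.
move: q; apply: poly_span_ind => [|a p q Lp Lq|k kn].
- by rewrite mul0r scalar_fun0.
- by rewrite mulrDl -scalerAl linL Lp Lq mulr0 addr0.
- by rewrite orthP (ltn_eqF kn).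
Qed.

(** Modulo polynomials of lower degree, which are orthogonal to [P n], the
    polynomial [q] is a multiple of [P n] that is read off the leading
    coefficients. *)
Lemma orthonormal_top n (q : {poly F}) : (size q <= n.+1)%N ->
  L (q * P n) = q`_n / lead_coef (P n).
Proof.
move=> sq; rewrite -[q in LHS](subrK ((q`_n / lead_coef (P n)) *: P n)).
rewrite mulrDl scalar_funD// orthonormal_lt ?size_cancel_top// add0r.
by rewrite -scalerAl scalar_funZ// orthP eqxx mulr1.
Qed.

(** Uniqueness of expansions. The coefficients of [q] are killed from the top,
    since the pairing with [P m] detects the coefficient of degree [m]. *)
Lemma orthonormal_eq0 m (q : {poly F}) : (size q <= m)%N ->
  (forall k, (k < m)%N -> L (q * P k) = 0) -> q = 0.
Proof.
elim: m => [|m IH] sq Lq.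
  by apply/eqP; move: sq; rewrite leqn0 size_poly_eq0.
have qm0 : q`_m = 0.
  have /eqP := Lq m (ltnSn m); rewrite orthonormal_top// mulf_eq0 invr_eq0.
  by rewrite (negPf (lead_coef_basis_neq0 m)) orbF => /eqP.
apply: IH => [|k km]; last by apply: Lq; exact: ltnW.
by have := size_cancel_top sq; rewrite qm0 mul0r scale0r subr0.
Qed.

End OrthonormalPolynomials.

(** * The two relations for an abstract moment functional *)

Section StructureRelations.
Variable F : fieldType.
Implicit Types p q : {poly F}.

Definition x2m1 : {poly F} := 'X ^+ 2 - 1.

(** With s the square root of x^2 - 1, this is s times the derivative of s p. *)
Definition wderiv (p : {poly F}) : {poly F} := x2m1 * p^`() + 'X * p.

Lemma coef_x2m1M p i : (x2m1 * p)`_i.+2 = p`_i - p`_i.+2.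
Proof. by rewrite mulrBl mul1r coefB coefXnM/= subn2. Qed.

Lemma coef_wderiv p i : (wderiv p)`_i.+1 = i.+1%:R * p`_i - i.+2%:R * p`_i.+2.
Proof.
rewrite coefD coefXM/=; case: i => [|i].
  rewrite mulrBl mul1r coefB coefXnM/= coef_deriv sub0r mul1r.
  by rewrite addrC mulr_natl.
rewrite coef_x2m1M !coef_deriv -[in X in X * _]natr1 mulrDl mul1r !mulr_natl.
by rewrite addrAC.
Qed.

Lemma size_wderiv p n : (size p <= n)%N -> (size (wderiv p) <= n.+1)%N.
Proof.
move=> sp; apply/leq_sizeP => -[//|j] nj; rewrite coef_wderiv.
by rewrite !nth_default ?mulr0 ?subr0//; apply: leq_trans sp _; lia.
Qed.

Lemma size_x2m1M p n : (size p <= n)%N -> (size (x2m1 * p)%R <= n.+2)%N.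
Proof.
move=> sp; apply/leq_sizeP => -[//|[//|j]] nj; rewrite coef_x2m1M.
by rewrite !nth_default ?subr0//; apply: leq_trans sp _; lia.
Qed.

Lemma wderivM p q : wderiv (p * q) = x2m1 * (p^`() * q) + p * wderiv q.
Proof. by rewrite /wderiv derivM; ring. Qed.

Variables (L : {poly F} -> F) (zeta : F) (P0 P1 : nat -> {poly F}).
Hypothesis linL : scalar L.
Hypothesis ibpL : forall p, L (wderiv p) = zeta * L (x2m1 * p).
Hypothesis sizeP0 : forall n, size (P0 n) = n.+1.
Hypothesis sizeP1 : forall n, size (P1 n) = n.+1.
Hypothesis orthP0 : forall m n, L (P0 m * P0 n) = (m == n)%:R.
Hypothesis orthP1 : forall m n, L (x2m1 * (P1 m * P1 n)) = (m == n)%:R.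

Let lead0 n : (P0 n)`_n = lead_coef (P0 n).
Proof. by rewrite lead_coefE sizeP0. Qed.
Let lead1 n : (P1 n)`_n = lead_coef (P1 n).
Proof. by rewrite lead_coefE sizeP1. Qed.

(** Integration by parts, obtained from [ibpL] at the product [p * q]. *)
Lemma adjoint_wderiv p q :
  L (x2m1 * (p^`() * q)) = L ((zeta *: (x2m1 * q) - wderiv q) * p).
Proof.
have E := ibpL (p * q); rewrite wderivM (scalar_funD linL) in E.
rewrite [(_ - _) * p]mulrBl -scalerAl (scalar_funB linL) (scalar_funZ linL).
by rewrite -mulrA [q * p]mulrC -E [wderiv q * p]mulrC addrK.
Qed.

(** The difference of the two sides has degree below [n], because the
    coefficients of degree [n] match; it is then orthogonal to each [P1 k] with
    [k < n], by [adjoint_wderiv]. *)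
Lemma deriv_orthonormal n :
  let Q := if n is m.+1 then P1 m else 0 in
  (P0 n.+1)^`() =
    (n.+1%:R * lead_coef (P0 n.+1) / lead_coef (P1 n)) *: P1 n
    + (zeta * (lead_coef Q / lead_coef (P0 n.+1))) *: Q.
Proof.
move=> Q; have szQ : (size Q <= n)%N.
  by rewrite /Q; case: (n) => [|m] /=; rewrite ?size_poly0 ?sizeP1.
set a := _ / lead_coef (P1 n); set b := zeta * _.
apply/eqP; rewrite -subr_eq0 opprD addrA; apply/eqP.
have linL1 := scalar_funMl linL x2m1.
have szd : (size (P0 n.+1)^`() <= n.+1)%N.
  by apply: leq_trans (size_poly _ _) _; rewrite sizeP0.
have topd : ((P0 n.+1)^`())`_n / lead_coef (P1 n) = a.
  by rewrite coef_deriv lead0 -mulr_natl.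
apply: (orthonormal_eq0 sizeP1 linL1 orthP1 (m := n)) => [|k kn].
  apply: (leq_trans (size_polyD _ _)); rewrite size_polyN geq_max.
  rewrite (leq_trans (size_scale_leq _ _) szQ) andbT -topd.
  exact: size_cancel_top.
rewrite 2![(_ - _) * P1 k]mulrBl 2!(scalar_funB linL1).
rewrite -!scalerAl !(scalar_funZ linL1) orthP1 (gtn_eqF kn) mulr0 subr0.
rewrite adjoint_wderiv.
set h := zeta *: _ - _.
(* The degree of [h] is at most [k.+2], so [h] pairs to 0 with [P0 n.+1] unless
   [k.+1 = n]. *)
have szh m : (k.+3 <= m)%N -> (size h <= m)%N.
  move=> km; apply: (leq_trans (size_polyD _ _)); rewrite size_polyN geq_max.
  rewrite (leq_trans (size_scale_leq _ _)).
    by rewrite (leq_trans (@size_wderiv _ k.+1 _)) ?sizeP1//; lia.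
  by rewrite (leq_trans (@size_x2m1M _ k.+1 _)) ?sizeP1//; lia.
case: n @Q @b @a kn topd szd {szQ} => [//|n] Q b a kn _ _.
rewrite {1}/Q.
rewrite orthP1; move: kn; rewrite ltnS leq_eqVlt => /predU1P[kn|kn].
  rewrite (orthonormal_top sizeP0 linL orthP0); last by apply: szh; lia.
  rewrite kn eqxx mulr1 coefB coefZ -kn coef_x2m1M coef_wderiv lead1.
  rewrite !(nth_default 0 (s := P1 k)) ?sizeP1//; last by lia.
  rewrite /b /Q -kn. by rewrite !(mulr0, subr0) mulrA subrr.
rewrite (gtn_eqF kn) mulr0 subr0.
by apply: (orthonormal_lt sizeP0 linL orthP0); apply: szh; lia.
Qed.

(** Here the coefficients of degree [n.+1] match, and the pairings with [P0 k]
    for [k <= n] are computed by [adjoint_wderiv], whose left-hand side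
    vanishes because the derivative of [P0 k] has degree below [n]. *)
Lemma wderiv_orthonormal n :
  wderiv (P1 n) =
    (n.+1%:R * (lead_coef (P1 n) / lead_coef (P0 n.+1))) *: P0 n.+1
    + (zeta * (lead_coef (P0 n) / lead_coef (P1 n))) *: P0 n.
Proof.
set a := n.+1%:R * _; set b := zeta * _.
apply/eqP; rewrite -subr_eq0 opprD addrA; apply/eqP.
have linL1 := scalar_funMl linL x2m1.
have szw : (size (wderiv (P1 n)) <= n.+2)%N.
  by apply: size_wderiv; rewrite sizeP1.
have topw : (wderiv (P1 n))`_n.+1 / lead_coef (P0 n.+1) = a.
  rewrite coef_wderiv lead1 [_`_n.+2]nth_default ?sizeP1//.
  by rewrite mulr0 subr0 -mulrA.
apply: (orthonormal_eq0 sizeP0 linL orthP0 (m := n.+1)) => [|k kn].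
  apply: (leq_trans (size_polyD _ _)); rewrite size_polyN geq_max -topw.
  by rewrite size_cancel_top//= (leq_trans (size_scale_leq _ _))// sizeP0.
rewrite 2![(_ - _) * P0 k]mulrBl 2!(scalar_funB linL).
rewrite -!scalerAl !(scalar_funZ linL) !orthP0 (gtn_eqF kn) mulr0 subr0.
have -> : L (wderiv (P1 n) * P0 k) = zeta * L (x2m1 * (P0 k * P1 n)).
  have := adjoint_wderiv (P0 k) (P1 n).
  rewrite (orthonormal_lt sizeP1 linL1 orthP1); last first.
    by apply: leq_trans (size_poly _ _) _; rewrite sizeP0/=.
  rewrite [(_ - _) * P0 k]mulrBl (scalar_funB linL) -scalerAl.
  rewrite (scalar_funZ linL) -mulrA.
  by rewrite [P1 n * P0 k]mulrC => /esym/eqP; rewrite subr_eq0 => /eqP.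
rewrite (orthonormal_top sizeP1 linL1 orthP1) ?sizeP0//.
move: kn; rewrite ltnS leq_eqVlt => /predU1P[->|kn].
  by rewrite eqxx mulr1 lead0 subrr.
by rewrite [_`_n]nth_default ?sizeP0// mul0r mulr0 (gtn_eqF kn) mulr0 subrr.
Qed.

End StructureRelations.

(** * The fundamental theorem of calculus on an unbounded interval *)

(** The derivative [f] may blow up at [a] and be of any sign, but it is assumed
    integrable: by dominated convergence its integral is the limit of the
    integrals over compact intervals exhausting ]a, +oo[. *)
Lemma integral_derivative_cvg (R : realType) (f F : R -> R) (a la lb : R) :
    lebesgue_measure.-integrable `]a, +oo[ (EFin \o f) ->
    (forall x, a < x -> is_derive x 1 F (f x)) ->
    (forall x, a < x -> {for x, continuous f}) ->
    F x @[x --> a^'+] --> la -> F x @[x --> +oo] --> lb ->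
  \int[lebesgue_measure]_(x in `[a, +oo[) f x = lb - la.
Proof.
move=> intf dF cf Fa Fb.
have intf' := measurable_int _ intf.
rewrite -Rintegral_itv_obnd_cbnd//.
(* The shift by 2 in the denominator gives [u n < a + 1 <= v n]. *)
pose u n : R := a + n.+2%:R^-1.
pose v n : R := a + n.+1%:R.
have au n : a < u n by rewrite ltrDl invr_gt0.
have uv n : u n < v n.
  by rewrite ltrD2l (@lt_le_trans _ _ 1)// ?invf_lt1 ?ltr1n ?ler1n.
have uva n : `[u n, v n] `<=` `]a, +oo[.
  by move=> x /=; rewrite !in_itv/= andbT => /andP[ux _]; exact: lt_le_trans ux.
have dFx x : a < x -> derivable F x 1 by move=> /dF[].
have cF x : a < x -> {for x, continuous F}.
  by move=> ax; apply/differentiable_continuous/derivable1_diffP/dFx.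
have FTC n : (\int[lebesgue_measure]_(x in `[u n, v n]) (f x)%:E =
    (F (v n))%:E - (F (u n))%:E)%E.
  apply: continuous_FTC2 => //.
  - apply: continuous_in_subspaceT => x; rewrite inE => /uva/=.
    by rewrite in_itv/= andbT => /cf.
  - split.
    + move=> x xuv; apply: dFx; apply: lt_trans (au n) _.
      by move: xuv; rewrite in_itv/= => /andP[].
    + by apply: cvg_at_right_filter; apply: cF.
    + by apply: cvg_at_left_filter; apply: cF; apply: lt_trans (uv n).
  - move=> x xuv; rewrite derive1E; have [|_ ->//] := dF x.
    by apply: lt_trans (au n) _; move: xuv; rewrite in_itv/= => /andP[].
pose f_ n := EFin \o (f \_ `[u n, v n]).
have u_cvg : u n @[n --> \oo] --> a.
  rewrite -[X in _ --> X]addr0; apply: cvgD; first exact: cvg_cst.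
  have := @cvg_harmonic R; rewrite -(cvg_shiftn 1).
  by under eq_fun do rewrite /= addn1.
have v_cvg : v n @[n --> \oo] --> +oo.
  apply/cvgryPge => A; near=> n; rewrite /v -lerBlDl.
  rewrite (@le_trans _ _ n%:R) ?ler_nat//.
  by near: n; exact: nbhs_infty_ger.
have cvg_f_ x : `]a, +oo[%classic x -> f_ ^~ x @ \oo --> (EFin \o f) x.
  rewrite /= in_itv/= andbT => ax.
  apply: cvg_near_cst; near=> n.
  rewrite /f_/= patchE mem_set//= in_itv/=; apply/andP; split.
    near: n; apply: (cvgr_le a) => //.
  near: n; exact: (cvgry_ge v_cvg).
have le_f_ x n : `]a, +oo[%classic x -> (`|f_ n x| <= `|(EFin \o f) x|)%E.
  by move=> _; rewrite /f_/= patchE; case: ifP => // _; rewrite normr0 lee_fin.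
have [|||_ _] := @dominated_convergence _ _ R lebesgue_measure _
  (measurable_itv _) f_ _ _ _ intf' _ (integrable_abse intf) _.
- move=> n; apply/measurable_EFinP/measurable_restrict => //.
  by apply/measurable_EFinP; exact: measurable_funS intf'.
- exact: aeW.
- exact: aeW.
have -> : [sequence (\int[lebesgue_measure]_(x in `]a, +oo[) f_ n x)%E]_n =
          (fun n => (F (v n) - F (u n))%:E).
  apply/funext => n; rewrite /= /f_ -restrict_EFin -integral_mkcondr.
  by rewrite setIidr// FTC.
move=> int_cvg.
have lim_cvg : (F (v n) - F (u n))%:E @[n --> \oo] --> (lb - la)%:E.
  apply: cvg_EFin; first exact: nearW.
  apply: cvgB.
    by move/cvg_pinftyP : Fb; apply.
  by move/cvg_at_rightP : Fa; apply.
by rewrite /Rintegral (cvg_unique _ int_cvg lim_cvg).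
Unshelve. all: by end_near. Qed.

(** * The two weights *)

Section Weight.
Context {R : realType}.
Implicit Types (zeta x : R) (p q : {poly R}).

Lemma besselK1_ge0 zeta : 0 <= besselK1 zeta.
Proof.
apply: Rintegral_ge0 => x _.
by rewrite mulr_ge0 ?expR_ge0// divr_ge0// addr_ge0 ?expR_ge0.
Qed.

Lemma weight_ge0 l zeta x : 0 <= weight l zeta x.
Proof.
by rewrite !mulr_ge0 ?invr_ge0 ?besselK1_ge0 ?powR_ge0 ?expR_ge0.
Qed.

Lemma sqrBone_gt0 x : 1 < x -> 0 < x ^+ 2 - 1.
Proof. by move=> x1; rewrite subr_gt0 expr_gt1// ltW// (lt_trans ltr01). Qed.

Let half_exp0 : 0%:R - 2^-1 = - 2^-1 :> R. Proof. by rewrite sub0r. Qed.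
Let half_exp1 : 1%:R - 2^-1 = 2^-1 :> R. Proof. by lra. Qed.

Lemma powR_half_split x : 0 < x -> x `^ 2^-1 = x * x `^ (- 2^-1).
Proof.
move=> x0; rewrite -[X in X * _](powRr1 (ltW x0)) -powRD; last first.
  by apply/implyP => _; rewrite gt_eqF.
by congr (_ `^ _); lra.
Qed.

(** Valid at [x = 1] as well, where both weights take the value 0. *)
Lemma weight1E zeta x : 1 <= x ->
  weight 1 zeta x = (x ^+ 2 - 1) * weight 0 zeta x.
Proof.
rewrite /weight half_exp0 half_exp1 le_eqVlt => /predU1P[<-|x1].
  by rewrite expr1n subrr powR0 ?invr_eq0// !(mulr0, mul0r).
rewrite powR_half_split; first by ring.
exact: sqrBone_gt0.
Qed.

Lemma weight1_sqrt zeta x : 1 <= x ->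
  weight 1 zeta x = (besselK1 zeta)^-1 * Num.sqrt (x ^+ 2 - 1)
                    * expR (- (zeta * x)).
Proof.
by move=> x1; rewrite /weight half_exp1 powR12_sqrt// subr_ge0 exprn_ege1.
Qed.

Lemma is_derive_weight l zeta x : 1 < x ->
  is_derive x 1 (weight l zeta) ((besselK1 zeta)^-1 * expR (- (zeta * x)) *
    ((l%:R - 2^-1) * (x ^+ 2 - 1) `^ (l%:R - 2^-1 - 1) * (2 * x)
     - zeta * (x ^+ 2 - 1) `^ (l%:R - 2^-1))).
Proof.
move=> x1; have u0 := sqrBone_gt0 x1.
have du : is_derive x 1 (fun y : R => y ^+ 2 - 1) (2 * x).
  by apply: is_derive_eq; rewrite subr0 /GRing.scale/=; ring.
have de : is_derive x 1 (fun y : R => - (zeta * y)) (- zeta).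
  by apply: is_derive_eq; rewrite /GRing.scale/= mulr1.
have dpow := is_derive1_comp (f := fun y : R => y `^ (l%:R - 2^-1))
  (g := fun y : R => y ^+ 2 - 1) (is_derive1_powR _ u0) du.
have dexp := is_derive1_comp (g := fun y : R => - (zeta * y))
  (is_derive_expR _) de.
have dw := is_deriveM (is_deriveZ (besselK1 zeta)^-1 dpow) dexp.
apply: (is_derive_eq dw); rewrite /GRing.scale/=.
rewrite -[_ *: (_ `^ _)]/((besselK1 zeta)^-1 * _).
ring.
Qed.

Lemma is_derive_weight1 zeta x : 1 < x ->
  is_derive x 1 (weight 1 zeta)
    ((x - zeta * (x ^+ 2 - 1)) * weight 0 zeta x).
Proof.
move=> x1; apply: (is_derive_eq (is_derive_weight 1 zeta x1)).
have -> : 1%:R - 2^-1 - 1 = - 2^-1 :> R by lra.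
rewrite /weight half_exp0 half_exp1 powR_half_split ?sqrBone_gt0//.
by move: (besselK1 zeta)^-1 => c; field.
Qed.

Lemma continuous_weight l zeta x : 1 < x -> {for x, continuous (weight l zeta)}.
Proof.
move=> /(is_derive_weight l zeta)[dw _].
exact/differentiable_continuous/derivable1_diffP.
Qed.

Lemma measurable_weight l zeta (D : set R) : measurable_fun D (weight l zeta).
Proof.
apply/measurable_funTS; apply: measurable_funM.
  apply: measurable_funM => //.
  apply: (measurableT_comp (@measurable_powR _ _)).
  by apply: measurable_funB => //; exact: measurable_funX.
by apply: measurableT_comp => //; apply: measurableT_comp.
Qed.

(** The bound y^(n+1) / (n+1)! <= exp y at y = zeta x gives one spare power of
    x, so that x^n exp (- zeta x) is O(1/x). *)
Lemma cvg_expr_expRN zeta n : 0 < zeta ->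
  x ^+ n * expR (- (zeta * x)) @[x --> +oo] --> (0 : R).
Proof.
move=> z0; pose C := (n.+1)`!%:R / zeta ^+ n.+1.
have C0 : 0 < C by rewrite divr_gt0 ?exprn_gt0// ltr0n fact_gt0.
apply: (@squeeze_cvgr _ _ _ _ (cst 0) (fun x => C * x^-1)); last 2 first.
- exact: cvg_cst.
- rewrite -[X in _ --> X](mulr0 C); apply: cvgM; first exact: cvg_cst.
  apply/gtr0_cvgV0 => //; exact: nbhs_pinfty_gt.
near=> x.
have x0 : 0 < x by [].
rewrite mulr_ge0 ?expR_ge0 ?exprn_ge0 ?(ltW x0)//=.
rewrite expRN ler_pdivrMr ?expR_gt0// mulrAC ler_pdivlMr// -exprSr.
have := @expR_ge1Dxn R (zeta * x) n (ltW (mulr_gt0 z0 x0)).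
rewrite -(ler_pM2l C0); apply: le_trans; rewrite mulrDr mulr1.
have -> : C * ((zeta * x) ^+ n.+1 / (n.+1)`!%:R) = x ^+ n.+1.
  rewrite exprMn /C; field.
  by rewrite expf_neq0 ?gt_eqF// ltr0n fact_gt0.
by rewrite lerDr ltW.
Unshelve. all: by end_near. Qed.

Lemma cvg_horner_expRN zeta p : 0 < zeta ->
  p.[x] * expR (- (zeta * x)) @[x --> +oo] --> (0 : R).
Proof.
move=> z0.
(* The extra factor [x ^+ n] makes the induction on [p] go through. *)
suff H n : p.[x] * (x ^+ n * expR (- (zeta * x))) @[x --> +oo] --> (0 : R).
  by have := H 0; under eq_cvg do rewrite expr0 mul1r.
elim/poly_ind: p n => [|p c IH] n.
  rewrite (_ : (fun x => _) = cst 0); first exact: cvg_cst.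
  by apply/funext => x; rewrite horner0 mul0r.
rewrite (_ : (fun x => _) = (fun x => p.[x] * (x ^+ n.+1 * expR (- (zeta * x)))
    + c * (x ^+ n * expR (- (zeta * x))))); last first.
  by apply/funext => x; rewrite hornerMXaddC exprS; ring.
have <- : 0 + c * 0 = 0 :> R by rewrite mulr0 addr0.
apply: cvgD; first exact: IH.
apply: cvgM; first exact: cvg_cst.
exact: cvg_expr_expRN.
Qed.

Lemma cvg_horner_weight1_pinfty zeta p : 0 < zeta ->
  p.[x] * weight 1 zeta x @[x --> +oo] --> (0 : R).
Proof.
move=> z0; apply/norm_cvg0P.
(* On [1, +oo[ the square root of x^2 - 1 is at most x. *)
have pX0 := @cvg_horner_expRN _ (p * 'X) z0.
apply: (@squeeze_cvgr _ _ _ _ (cst 0)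
  (fun x => (besselK1 zeta)^-1 * `|(p * 'X).[x] * expR (- (zeta * x))|)).
- near=> x.
  have x1 : 1 <= x by near: x; exact: nbhs_pinfty_ge.
  have x0 : 0 <= x by exact: le_trans x1.
  rewrite normr_ge0/= weight1_sqrt// hornerMX !normrM.
  rewrite !(ger0_norm (expR_ge0 _)) (ger0_norm (sqrtr_ge0 _)) (ger0_norm x0).
  have K0 : 0 <= (besselK1 zeta)^-1 by rewrite invr_ge0 besselK1_ge0.
  rewrite (ger0_norm K0).
  have sx : Num.sqrt (x ^+ 2 - 1) <= x.
    by rewrite -[leRHS](ger0_norm x0) -sqrtr_sqr ler_wsqrtr// gerBl.
  have c0 : 0 <= (besselK1 zeta)^-1 * (`|p.[x]| * expR (- (zeta * x))).
    by rewrite !mulr_ge0 ?expR_ge0.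
  by have := ler_wpM2l c0 sx; congr (_ <= _); ring.
- exact: cvg_cst.
- rewrite -[X in _ --> X](mulr0 (besselK1 zeta)^-1).
  apply: cvgM; first exact: cvg_cst.
  by apply/norm_cvg0P.
Unshelve. all: by end_near. Qed.

Lemma cvg_horner_weight1_one zeta p :
  p.[x] * weight 1 zeta x @[x --> 1^'+] --> (0 : R).
Proof.
(* Written with a square root, the weight extends continuously across 1. *)
pose g x := p.[x] * ((besselK1 zeta)^-1 * Num.sqrt (x ^+ 2 - 1)
                    * expR (- (zeta * x))).
apply: (@cvg_trans _ (g x @[x --> 1^'+])).
  by apply: near_eq_cvg; near=> x; rewrite /g weight1_sqrt.
have -> : 0 = g 1 by rewrite /g expr1n subrr sqrtr0 mulr0 mul0r mulr0.
apply: cvg_at_right_filter; apply: cvgM; first exact: continuous_horner.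
apply: cvgM; last first.
  apply: continuous_comp; last exact: continuous_expR.
  by apply: cvgN; apply: cvgM; [exact: cvg_cst|exact: cvg_id].
apply: cvgM; first exact: cvg_cst.
apply: continuous_comp; last exact: sqrt_continuous.
by apply: cvgB; [exact: exprn_continuous|exact: cvg_cst].
Unshelve. all: by end_near. Qed.

End Weight.

(** * The moment functional *)

Section Moments.
Context {R : realType}.
Implicit Types (zeta x : R) (p q : {poly R}).

Definition weight_integrable l zeta p : Prop :=
  lebesgue_measure.-integrable (`[1, +oo[ : set R)
    (EFin \o (fun x => p.[x] * weight l zeta x)).

Lemma measurable_horner_weight l zeta p (D : set R) :
  measurable_fun D (fun x => p.[x] * weight l zeta x).
Proof.
apply: measurable_funM; last exact: measurable_weight.
exact: measurable_poly.
Qed.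

Lemma weight_integrable_scale_add l zeta (a : R) p q :
    weight_integrable l zeta p -> weight_integrable l zeta q ->
  weight_integrable l zeta (a *: p + q).
Proof.
move=> intp intq.
have mI : measurable (`[1, +oo[ : set (measurableTypeR R)) by [].
have := integrableD mI (integrableZl mI a intp) intq.
apply: eq_integrable => // x _ /=.
by rewrite hornerD hornerZ mulrDl -mulrA.
Qed.

(** An integral whose finite part is 1 is finite, so the squares [P n ^+ 2] are
    integrable against the weight. Then so are the products of the constant
    [P 0] with [P n], by comparison with the sum of the squares, hence every
    [P n], and finally every polynomial by linearity. *)
Lemma orthonormal_polys_integrable l zeta (P : nat -> {poly R}) p :
  orthonormal_polys l zeta P -> weight_integrable l zeta p.
Proof.
move=> [sizeP leadP orthP].
have intsqr n : weight_integrable l zeta (P n * P n).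
  have ge0 x : 0 <= (P n * P n).[x] * weight l zeta x.
    by rewrite hornerM mulr_ge0 ?weight_ge0// -expr2 sqr_ge0.
  apply/integrableP; split.
    by apply/measurable_EFinP; exact: measurable_horner_weight.
  under eq_integral => x _ do rewrite /= ger0_norm//.
  have := orthP n n; rewrite eqxx /wdot /Rintegral.
  under eq_integral => x _ do rewrite -hornerM.
  case: (X in fine X = _) => [r _|/= /esym/eqP|/= /esym/eqP];
    by rewrite ?ltry ?oner_eq0.
have intmul n : weight_integrable l zeta (P 0%N * P n).
  have := weight_integrable_scale_add 1 (intsqr 0%N) (intsqr n).
  apply: le_integrable => //.
    by apply/measurable_EFinP; exact: measurable_horner_weight.
  move=> x _ /=; rewrite lee_fin !normrM ler_wpM2r//.
  rewrite hornerD scale1r !hornerM.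
  (* |a b| <= a^2 + b^2 follows from (|a| - |b|)^2 >= 0. *)
  have := sqr_ge0 (`|(P 0%N).[x]| - `|(P n).[x]|).
  set a := (P 0%N).[x]; set b := (P n).[x] => ab.
  apply: le_trans (ler_norm _); rewrite normrM -!expr2.
  rewrite -(real_normK (num_real a)) -(real_normK (num_real b)).
  move: ab (normr_ge0 a) (normr_ge0 b); nra.
have P0E : P 0%N = (lead_coef (P 0%N))%:P.
  by rewrite lead_coefE sizeP; apply: size1_polyC; rewrite sizeP.
have int0 : weight_integrable l zeta 0.
  apply: eq_integrable (integrable0 _ _) => // x _ /=.
  by rewrite horner0 mul0r.
have intP n : weight_integrable l zeta (P n).
  have := weight_integrable_scale_add (lead_coef (P 0%N))^-1 (intmul n) int0.
  rewrite addr0 {2}P0E mul_polyC scalerA mulVf ?scale1r//.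
  by rewrite gt_eqF.
apply: (poly_span_ind sizeP) (leqnn (size p)) => //.
by move=> a q r; exact: weight_integrable_scale_add.
Qed.

Definition moment zeta p : R :=
  \int[lebesgue_measure]_(x in `[1, +oo[) (p.[x] * weight 0 zeta x).

Lemma wdot0_moment zeta p q :
  wdot 0 zeta (horner p) (horner q) = moment zeta (p * q).
Proof. by apply: eq_Rintegral => x _; rewrite hornerM. Qed.

Lemma horner_x2m1 x : (x2m1 R).[x] = x ^+ 2 - 1.
Proof. by rewrite /x2m1 !hornerE. Qed.

Lemma wdot1_moment zeta p q :
  wdot 1 zeta (horner p) (horner q) = moment zeta (x2m1 R * (p * q)).
Proof.
apply: eq_Rintegral => x; rewrite inE/= in_itv/= andbT => x1.
by rewrite weight1E// !hornerM horner_x2m1; ring.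
Qed.

Section MomentFunctional.
Variable zeta : R.
Hypothesis zeta0 : 0 < zeta.
Hypothesis intw : forall p, weight_integrable 0 zeta p.

Lemma moment_scalar : scalar (moment zeta).
Proof.
move=> a p q.
have mI : measurable (`[1, +oo[ : set (measurableTypeR R)) by [].
have intap : lebesgue_measure.-integrable `[1, +oo[
    (EFin \o (fun x => a * (p.[x] * weight 0 zeta x))).
  by apply: eq_integrable (integrableZl mI a (intw p)).
rewrite /moment -(RintegralZl _ mI (intw p)) -(RintegralD mI intap (intw q)).
by apply: eq_Rintegral => x _; rewrite hornerD hornerZ mulrDl mulrA.
Qed.

(** The left-hand side minus the right-hand side is the integral of the
    derivative of [p] times the weight of index 1, which vanishes at both
    ends. *)
Lemma moment_wderiv p :
  moment zeta (wderiv p) = zeta * moment zeta (x2m1 R * p).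
Proof.
apply/eqP; rewrite -subr_eq0 -(scalar_funZ moment_scalar).
rewrite -(scalar_funB moment_scalar) /moment; apply/eqP.
set q := wderiv p - _; rewrite -[RHS](subrr 0).
apply: (@integral_derivative_cvg _ _ (fun x => p.[x] * weight 1 zeta x)).
- by apply: integrableS (intw q) => // x/=; rewrite !in_itv/= !andbT => /ltW.
- move=> x x1.
  have dF := is_deriveM (is_derive_poly p x) (is_derive_weight1 zeta x1).
  apply: (is_derive_eq dF); rewrite /GRing.scale/= weight1E ?ltW//.
  rewrite /q /wderiv hornerD hornerN hornerZ hornerD !hornerM hornerX.
  by rewrite horner_x2m1; ring.
- move=> x x1; apply: cvgM; first exact: continuous_horner.
  exact: continuous_weight.
- exact: cvg_horner_weight1_one.
- exact: cvg_horner_weight1_pinfty.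
Qed.

End MomentFunctional.
End Moments.

(** * The derivative relations *)

Theorem theorem3p4 (R : realType) (zeta : R) (P0 P1 : nat -> {poly R})
    (hzeta : 0 < zeta)
    (hP0 : orthonormal_polys 0 zeta P0) (hP1 : orthonormal_polys 1 zeta P1)
    (n : nat) (x : R) :
  derive1 (horner (P0 n.+1)) x =
    n.+1%:R / pt_coef P0 P1 n * (P1 n).[x]
    + zeta * r_coef P0 P1 n * (prev_poly P1 n).[x]
  /\
  (x ^+ 2 - 1) * derive1 (horner (P1 n)) x + x * (P1 n).[x] =
    n.+1%:R * pt_coef P0 P1 n * (P0 n.+1).[x]
    + zeta * p_coef P0 P1 n * (P0 n).[x].
Proof.
have intw p := orthonormal_polys_integrable p hP0.
have linL := moment_scalar intw.
have ibpL := moment_wderiv hzeta intw.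
case: hP0 hP1 => [sizeP0 _ orthP0] [sizeP1 _ orthP1].
have orth0 i j : moment zeta (P0 i * P0 j) = (i == j)%:R.
  by rewrite -wdot0_moment.
have orth1 i j : moment zeta (x2m1 R * (P1 i * P1 j)) = (i == j)%:R.
  by rewrite -wdot1_moment.
rewrite -!derivE; split.
  rewrite (deriv_orthonormal linL ibpL sizeP0 sizeP1 orth0 orth1).
  by rewrite hornerD !hornerZ /pt_coef invf_div -[_ * _ / lead_coef _]mulrA.
rewrite -horner_x2m1 -[X in X * (P1 n).[x]]hornerX -!hornerM -hornerD.
have := wderiv_orthonormal linL ibpL sizeP0 sizeP1 orth0 orth1 n.
by rewrite /wderiv => ->; rewrite hornerD !hornerZ.
Qed.
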